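(* Let $\ast$ be a binary operation on $I=[0,1]$ and let $\nabla$ be a t-conorm on $I$. Then the following statements are equivalent: (1) $\widetilde{\nabla}_{\ast}$ satisfies axiom (O6), i.e. $\widetilde{\nabla}_{\ast}$ is closed on $\mathbf{J}=\{\bm{1}_{\{x\}}\mid x\in I\}$; (2) $0\ast 0=0\ast 1=1\ast 0=0$ and $1\ast 1=1$; (3) for all $x_1,x_2\in I$, $\bm{1}_{\{x_1\}}\,\widetilde{\nabla}_{\ast}\,\bm{1}_{\{x_2\}}=\bm{1}_{\{x_1\nabla x_2\}}$.
   Context: Let $I=[0,1]$ and let $\mathbf{M}$ be the set of all maps $I\to I$. For $B\subseteq I$, $\bm{1}_B\in\mathbf{M}$ is the characteristic function of $B$. A t-conorm on $I$ is a binary operation $I^2\to I$ that is commutative, associative, increasing (non-decreasing) in each argument, and has neutral element $0$. Given a binary operation $\ast:I^2\to I$ (arbitrary) and a t-conorm $\nabla$ on $I$, the binary operation $\widetilde{\nabla}_{\ast}:\mathbf{M}^2\to\mathbf{M}$ is defined by $$(f\,\widetilde{\nabla}_{\ast}\,g)(x)=\sup\{f(y)\ast g(z)\mid y,z\in I,\ y\nabla z=x\},\qquad f,g\in\mathbf{M},\ x\in I.$$ Closed on $\mathbf{J}$ means that $f\,\widetilde{\nabla}_{\ast}\,g\in\mathbf{J}$ for all $f,g\in\mathbf{J}$. *)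

(* Defs.v *)
From HB Require Import structures.
From mathcomp Require Import all_boot all_order all_algebra.
From mathcomp Require Import mathcomp_extra boolp classical_sets reals
  interval_inference.

Set Implicit Arguments.
Unset Strict Implicit.
Unset Printing Implicit Defensive.

Import Order.TTheory GRing.Theory Num.Theory.
Local Open Scope classical_set_scope.
Local Open Scope ring_scope.

(* The unit interval I = [0, 1] is the library type {i01 R}; the set of all
   maps I -> I is the function type {i01 R} -> {i01 R}. *)

Record is_tconorm (R : realType) (nabla : {i01 R} -> {i01 R} -> {i01 R}) :
    Prop := IsTconorm {
  tconormC : commutative nabla ;
  tconormA : associative nabla ;
  tconorm_homol : forall z, {homo (fun x => nabla x z) : x y / x <= y} ;
  tconorm_homor : forall z, {homo (fun x => nabla z x) : x y / x <= y} ;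
  tconorm0x : left_id 0%:i01 nabla ;
  tconormx0 : right_id 0%:i01 nabla
}.

Definition char_fun (R : realType) (B : set {i01 R}) : {i01 R} -> {i01 R} :=
  fun x => if x \in B then 1%:i01 else 0%:i01.

(* The supremum is taken in the ordered type {i01 R}.  The default value 0 is
   the supremum of the empty set in I, so sup01 is the least upper bound of
   every subset of I (lemma sup01P). *)
Definition sup01 (R : realType) (A : set {i01 R}) : {i01 R} :=
  supremum 0%:i01 A.

Lemma sup01P (R : realType) (A : set {i01 R}) : isLub A (sup01 A).
Proof.
rewrite /sup01 /supremum; case: ifPn => [/eqP->|/set0P[a Aa]].
  by split => [x //|b _]; rewrite -num_le /=.
pose B : set R := [set x%:num | x in A].
have B1 : ubound B 1 by move=> _ [x Ax <-].
have supB : has_sup B by split; [exists a%:num; exists a|exists 1].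
have ubB x : A x -> x%:num <= sup B.
  by move=> Ax; apply: sup_upper_bound => //; exists x.
have s0 : 0 <= sup B by apply: le_trans (ubB _ Aa).
have s1 : sup B <= 1 by apply: ge_sup => //; exists a%:num; exists a.
have [] // := @xgetPex _ 0%:i01 (supremums A).
exists (Itv01 s0 s1); split => [x /ubB|b Ab]; rewrite -num_le//=.
by apply: ge_sup => [|_ [x /Ab Ax <-]]; [exists a%:num; exists a|rewrite num_le].
Qed.

Definition tconv (R : realType) (ast nabla : {i01 R} -> {i01 R} -> {i01 R})
    (f g : {i01 R} -> {i01 R}) : {i01 R} -> {i01 R} :=
  fun x => sup01 [set t | exists y z, nabla y z = x /\ t = ast (f y) (g z)].

Definition closed_on (M : Type) (op : M -> M -> M) (J : set M) : Prop :=
  forall f g, J f -> J g -> J (op f g).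

Definition Jset (R : realType) : set ({i01 R} -> {i01 R}) :=
  [set char_fun [set x] | x in [set: {i01 R}]].
Arguments Jset : clear implicits.

(* Main.v *)
Require Import Defs.
From HB Require Import structures.
From mathcomp Require Import all_boot all_order all_algebra.
From mathcomp Require Import mathcomp_extra boolp classical_sets reals
  interval_inference.

(** As [nabla y z] bounds [y] and [z] from above, the inverse image of [0]
    under a t-conorm is the single pair [(0, 0)] ([tconorm_eq0]), so
    [tconv f g] takes at [0] the exact value [ast (f 0) (g 0)] ([tconv_at0]);
    elsewhere the values [ast (f y) (g z)] only bound it from below
    ([ast_le_tconv]).

    Closure on singletons forces [ast 0 b = 0] for [b] in [{0, 1}]: with [f]
    the characteristic function of [{1}] and [g] that of a singleton such that
    [g 0 = b], the number [ast 0 b] is the value of [tconv f g] at [0] and a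
    lower bound of its value at [1/2], as [f] vanishes at both points and
    [1/2 = nabla (1/2) 0].  A characteristic function of a singleton vanishes
    at one of the two points, so [ast 0 b = 0] ([ast0_closed]).  Exchanging the
    arguments of [ast] ([tconv_flip]) yields [ast 1 0 = 0].

    Once these three products vanish, the convolution of the characteristic
    functions of [{x1}] and [{x2}] is [ast 1 1] at [nabla x1 x2] and [0]
    elsewhere ([tconv_char]).  Such a function is the characteristic function
    of a singleton exactly when [ast 1 1 = 1], and the singleton is then
    [{nabla x1 x2}]. *)

Set Implicit Arguments.
Unset Strict Implicit.
Unset Printing Implicit Defensive.

Import Order.TTheory GRing.Theory Num.Theory.
Local Open Scope classical_set_scope.
Local Open Scope ring_scope.

Lemma i01_ge0 (R : realType) (x : {i01 R}) : 0%:i01 <= x.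
Proof. by rewrite -num_le /=. Qed.

Lemma i01_le0 (R : realType) (x : {i01 R}) : x <= 0%:i01 -> x = 0%:i01.
Proof. by move=> x0; apply/le_anti; rewrite x0 i01_ge0. Qed.

Lemma i01_1neq0 (R : realType) : 1%:i01 != 0%:i01 :> {i01 R}.
Proof. by rewrite -num_eq /= oner_eq0. Qed.

Lemma char_fun1E (R : realType) (a x : {i01 R}) :
  char_fun [set a] x = if x == a then 1%:i01 else 0%:i01.
Proof.
rewrite /char_fun; case: eqP => [->|xa]; first by rewrite mem_set.
by rewrite memNset.
Qed.

(** Monotonicity and neutrality of [0] make [nabla y z] an upper bound of [y]
    and [z]. *)
Lemma tconorm_eq0 (R : realType) (nabla : {i01 R} -> {i01 R} -> {i01 R})
    (nablaP : is_tconorm nabla) (y z : {i01 R}) :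
  nabla y z = 0%:i01 -> y = 0%:i01 /\ z = 0%:i01.
Proof.
move=> yz0; split; apply: i01_le0; rewrite -yz0.
- by rewrite -[leLHS](tconormx0 nablaP) (tconorm_homor nablaP) ?i01_ge0.
- by rewrite -[leLHS](tconorm0x nablaP) (tconorm_homol nablaP) ?i01_ge0.
Qed.

Section Convolution.
Variables (R : realType) (ast nabla : {i01 R} -> {i01 R} -> {i01 R}).
Implicit Types (f g : {i01 R} -> {i01 R}) (x y z t : {i01 R}).

Lemma ast_le_tconv f g y z : ast (f y) (g z) <= tconv ast nabla f g (nabla y z).
Proof.
have [ub _] := sup01P [set t | exists y' z',
  nabla y' z' = nabla y z /\ t = ast (f y') (g z')].
by apply: ub; exists y, z.
Qed.

Lemma tconv_le f g x t :
  (forall y z, nabla y z = x -> ast (f y) (g z) <= t) ->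
  tconv ast nabla f g x <= t.
Proof.
move=> le_t; have [_ lub] := sup01P [set t | exists y z,
  nabla y z = x /\ t = ast (f y) (g z)].
by apply: lub => _ [y [z [yzx ->]]]; apply: le_t.
Qed.

Hypothesis nablaP : is_tconorm nabla.

Lemma tconv_at0 f g :
  tconv ast nabla f g 0%:i01 = ast (f 0%:i01) (g 0%:i01).
Proof.
apply/le_anti/andP; split.
  by apply: tconv_le => y z /(tconorm_eq0 nablaP)[-> ->].
by rewrite -[X in tconv _ _ _ _ X](tconormx0 nablaP); exact: ast_le_tconv.
Qed.

(** [1/2] serves as a second point, besides [0], at which the characteristic
    function of [{1}] vanishes. *)
Lemma ast0_closed g : closed_on (tconv ast nabla) (Jset R) -> Jset R g ->
  ast 0%:i01 (g 0%:i01) = 0%:i01.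
Proof.
move=> cl Jg.
have half_ge0 : 0 <= 2^-1 :> R by rewrite invr_ge0 ler0n.
have half_le1 : 2^-1 <= 1 :> R by rewrite invf_le1 ?ltr0n// ler1n.
pose h : {i01 R} := Itv01 half_ge0 half_le1.
have h0 : h != 0%:i01 by rewrite -num_eq /= invr_eq0 pnatr_eq0.
have h1 : h != 1%:i01 by rewrite -num_eq /= invr_eq1 (eqr_nat R 2 1).
have [f [Jf f0 fh]] : exists f, [/\ Jset R f, f 0%:i01 = 0%:i01 & f h = 0%:i01].
  exists (char_fun [set 1%:i01]); split; first by exists 1%:i01.
    by rewrite char_fun1E eq_sym (negbTE (i01_1neq0 R)).
  by rewrite char_fun1E (negbTE h1).
have [x _ fgx] := cl f g Jf Jg.
have at0 := tconv_at0 f g.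
have ath : ast (f h) (g 0%:i01) <= tconv ast nabla f g h.
  by rewrite -[X in tconv _ _ _ _ X](tconormx0 nablaP); exact: ast_le_tconv.
move: at0 ath; rewrite f0 fh -fgx !char_fun1E.
case: eqP => [<- _|_ <-//]; rewrite (negbTE h0); exact: i01_le0.
Qed.

Lemma tconv_char x1 x2 :
  ast 0%:i01 0%:i01 = 0%:i01 -> ast 0%:i01 1%:i01 = 0%:i01 ->
  ast 1%:i01 0%:i01 = 0%:i01 ->
  tconv ast nabla (char_fun [set x1]) (char_fun [set x2]) =
  fun x => if x == nabla x1 x2 then ast 1%:i01 1%:i01 else 0%:i01.
Proof.
move=> a00 a01 a10; apply/funext => x; apply/le_anti/andP; split.
  apply: tconv_le => y z <-; rewrite !char_fun1E.
  case: (y =P x1) => [->|_]; case: (z =P x2) => [->|_];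
    by rewrite ?eqxx ?a00 ?a01 ?a10 ?i01_ge0.
case: eqP => [->|_]; last exact: i01_ge0.
have := ast_le_tconv (char_fun [set x1]) (char_fun [set x2]) x1 x2.
by rewrite !char_fun1E !eqxx.
Qed.

End Convolution.

(** Commutativity of [nabla] makes every fact about the left argument of [ast]
    hold for the right one. *)
Lemma tconv_flip (R : realType) (ast nabla : {i01 R} -> {i01 R} -> {i01 R})
    (nablaP : is_tconorm nabla) (f g : {i01 R} -> {i01 R}) :
  tconv (fun a b => ast b a) nabla f g = tconv ast nabla g f.
Proof.
apply/funext => x; apply/le_anti/andP.
by split; apply: tconv_le => y z <-; rewrite (tconormC nablaP);
  [exact: (ast_le_tconv ast)|exact: (ast_le_tconv (fun a b => ast b a))].
Qed.

Theorem theorem13 (R : realType) (ast nabla : {i01 R} -> {i01 R} -> {i01 R})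
    (nablaP : is_tconorm nabla) :
  let P1 := closed_on (tconv ast nabla) (Jset R) in
  let P2 := [/\ ast 0%:i01 0%:i01 = 0%:i01, ast 0%:i01 1%:i01 = 0%:i01,
                ast 1%:i01 0%:i01 = 0%:i01 & ast 1%:i01 1%:i01 = 1%:i01] in
  let P3 := forall x1 x2 : {i01 R},
    tconv ast nabla (char_fun [set x1]) (char_fun [set x2]) =
    char_fun [set nabla x1 x2] in
  (P1 <-> P2) /\ (P2 <-> P3).
Proof.
move=> P1 P2 P3.
have P12 : P1 -> P2.
  move=> cl.
  have J1 : Jset R (char_fun [set 1%:i01]) by exists 1%:i01.
  have J0 : Jset R (char_fun [set 0%:i01]) by exists 0%:i01.
  have clf : closed_on (tconv (fun a b => ast b a) nabla) (Jset R).
    by move=> f g Jf Jg; rewrite tconv_flip //; apply: cl.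
  have a00 := ast0_closed nablaP cl J1.
  have a01 := ast0_closed nablaP cl J0.
  have a10 := ast0_closed nablaP clf J0.
  move: a00 a01 a10; rewrite !char_fun1E eqxx eq_sym (negbTE (i01_1neq0 R)).
  move=> a00 a01 a10; split => //.
  (* Evaluated at [x], the characteristic function of [{x}] is [1], while the
     convolution is [ast 1 1] or [0]. *)
  have [x _] := cl _ _ J0 J0; rewrite tconv_char // => /(congr1 (@^~ x)).
  rewrite char_fun1E eqxx; case: ifP => // _ /eqP.
  by rewrite (negbTE (i01_1neq0 R)).
have P23 : P2 -> P3.
  move=> [a00 a01 a10 a11] x1 x2; rewrite tconv_char //.
  by apply/funext => x; rewrite char_fun1E a11.
have P31 : P3 -> P1.
  by move=> p3 _ _ [x1 _ <-] [x2 _ <-]; rewrite p3; exists (nabla x1 x2).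
by split; split => // p; [apply/P31/P23|apply/P12/P31].
Qed.
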